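(* Let $h\in\Gamma_0(\mathbb{R}^N)$, and let $V=D\pm uu^\top$ be symmetric positive definite (one fixed choice of sign), where $D$ is diagonal with strictly positive diagonal entries $d_i$ and $u\in\mathbb{R}^N$. Then, for every $x\in\mathbb{R}^N$, $$\mathrm{prox}^V_h(x)=D^{-1/2}\,\mathrm{prox}_{h\circ D^{-1/2}}\big(D^{1/2}(x\mp\alpha^\star D^{-1}u)\big),$$ where $\alpha^\star$ is the unique root of $$\mathcal{L}(\alpha)=\Big\langle u,\;x-D^{-1/2}\,\mathrm{prox}_{h\circ D^{-1/2}}\big(D^{1/2}(x\mp\alpha D^{-1}u)\big)\Big\rangle+\alpha,$$ which is a strongly increasing and Lipschitz continuous function on $\mathbb{R}$ with Lipschitz constant $1+\sum_i u_i^2/d_i$. (Upper signs correspond to $V=D+uu^\top$, lower signs to $V=D-uu^\top$.)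
   Context: $\Gamma_0(\mathbb{R}^N)$: proper lower semicontinuous convex functions $\mathbb{R}^N\to\mathbb{R}\cup\{+\infty\}$. For $V$ symmetric positive definite, $\|x\|_V^2=\langle x,Vx\rangle$ and $\mathrm{prox}^V_h(x)=\operatorname{argmin}_{z\in\mathbb{R}^N}\{h(z)+\tfrac12\|x-z\|_V^2\}$; $\mathrm{prox}_h=\mathrm{prox}_h^{\mathrm{Id}}$. A function $\mathcal{L}:\mathbb{R}\to\mathbb{R}$ is strongly increasing if there is $c>0$ with $(\mathcal{L}(\alpha)-\mathcal{L}(\beta))(\alpha-\beta)\ge c(\alpha-\beta)^2$ for all $\alpha,\beta\in\mathbb{R}$. *)

(* Defs.v *)
From mathcomp Require Import all_boot all_order all_algebra.
From mathcomp Require Import all_classical all_reals all_analysis.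

Set Implicit Arguments.
Unset Strict Implicit.
Unset Printing Implicit Defensive.

Import Order.TTheory GRing.Theory Num.Theory.
Import numFieldNormedType.Exports.

Local Open Scope classical_set_scope.
Local Open Scope ring_scope.

Definition inner (R : realType) (N : nat) (x y : 'cV[R]_N) : R :=
  \sum_(i < N) x i 0 * y i 0.

Definition sqnorm (R : realType) (N : nat) (V : 'M[R]_N) (x : 'cV[R]_N) : R :=
  inner x (V *m x).

Definition sym_posdef (R : realType) (N : nat) (V : 'M[R]_N) : Prop :=
  V \is symmetricmx /\ forall x : 'cV[R]_N, x != 0 -> 0 < inner x (V *m x).

Definition proper_fun (T : Type) (R : realType) (h : T -> \bar R) : Prop :=
  (forall x, h x != -oo%E) /\ exists x, h x != +oo%E.

(* For a function omitting -oo the right-hand side is never of the form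
   +oo - oo; at t = 0 or t = 1 the convention 0 * +oo = 0 makes the
   inequality trivial, as it should be. *)
Definition convex_efun (R : realType) (N : nat) (h : 'cV[R]_N -> \bar R) : Prop :=
  forall (x y : 'cV[R]_N) (t : R), 0 <= t <= 1 ->
    (h (t *: x + (1 - t) *: y)%R <= t%:E * h x + (1 - t)%:E * h y)%E.

Definition Gamma0 (R : realType) (N : nat) (h : 'cV[R]_N -> \bar R) : Prop :=
  [/\ proper_fun h, lower_semicontinuous h & convex_efun h].

Definition argmin (T : Type) (R : realType) (f : T -> \bar R) : set T :=
  [set z | forall y, (f z <= f y)%E].

Definition prox_set (R : realType) (N : nat) (V : 'M[R]_N)
    (h : 'cV[R]_N -> \bar R) (x : 'cV[R]_N) : set 'cV[R]_N :=
  argmin (fun z => (h z + (2^-1 * sqnorm V (x - z))%:E)%E).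

(* A choice of minimiser, with default value 0 if there is none; it is the
   proximal point exactly when prox_set V h x is a singleton. *)
Definition prox (R : realType) (N : nat) (V : 'M[R]_N)
    (h : 'cV[R]_N -> \bar R) (x : 'cV[R]_N) : 'cV[R]_N :=
  xget 0 (prox_set V h x).

Definition strongly_increasing (R : realType) (L : R -> R) : Prop :=
  exists2 c : R, 0 < c &
    forall a b : R, c * (a - b) ^+ 2 <= (L a - L b) * (a - b).

Definition diag_sqrt (R : realType) (N : nat) (d : 'rV[R]_N) : 'M[R]_N :=
  diag_mx (map_mx Num.sqrt d).

(* The sign s = false stands for V = D + u u^T and s = true for
   V = D - u u^T, where D = diag_mx d. *)
Definition diag_pm_rank1 (R : realType) (N : nat) (s : bool) (d : 'rV[R]_N)
    (u : 'cV[R]_N) : 'M[R]_N :=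
  diag_mx d + (-1) ^+ s *: (u *m u^T).

(* D^{-1/2} prox_{h o D^{-1/2}} (D^{1/2} (x -/+ a D^{-1} u)) *)
Definition shifted_prox (R : realType) (N : nat) (s : bool) (d : 'rV[R]_N)
    (u : 'cV[R]_N) (h : 'cV[R]_N -> \bar R) (x : 'cV[R]_N) (a : R) : 'cV[R]_N :=
  invmx (diag_sqrt d) *m
    prox 1%:M (h \o mulmx (invmx (diag_sqrt d)))
      (diag_sqrt d *m (x - (-1) ^+ s *: (a *: (invmx (diag_mx d) *m u)))).

Definition root_fun (R : realType) (N : nat) (s : bool) (d : 'rV[R]_N)
    (u : 'cV[R]_N) (h : 'cV[R]_N -> \bar R) (x : 'cV[R]_N) (a : R) : R :=
  inner u (x - shifted_prox s d u h x a) + a.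

(* Main.v *)
Require Import Defs.
From mathcomp Require Import all_boot all_order all_algebra.
From mathcomp Require Import all_classical all_reals all_analysis.
From mathcomp Require Import ring lra.

Set Implicit Arguments.
Unset Strict Implicit.
Unset Printing Implicit Defensive.

Import Order.TTheory GRing.Theory Num.Theory.
Import numFieldNormedType.Exports.

Local Open Scope classical_set_scope.
Local Open Scope ring_scope.

(* A point z is prox^V_h(x) iff V (x - z) is a subgradient of h at z. For
   V = D + e u u^T with e = +1 or -1 one has
   V (x - z) = D (x - z) + e <u, x - z> u, whereas z(a) = shifted_prox a is
   characterised by D (x - z) - e a u being a subgradient of h at z; the two
   conditions agree when a = - <u, x - z>, i.e. at a root of root_fun.
   Monotonicity of the subdifferential and Cauchy-Schwarz for D give, for
   q = <u, z(a) - z(b)> and k = <u, D^-1 u>, the inequality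
   q^2 <= - k e (a - b) q, which yields both the Lipschitz bound and strong
   monotonicity; for e = -1 the latter uses k < 1, which is positive
   definiteness of V tested at D^-1 u. *)

(** * Bilinear algebra of the inner product, and comparison with the norm *)

Lemma innerE (R : realType) (N : nat) (x y : 'cV[R]_N) :
  inner x y = (x^T *m y) 0 0.
Proof. by rewrite mxE; apply: eq_bigr => i _; rewrite mxE. Qed.

Lemma innerC (R : realType) (N : nat) (x y : 'cV[R]_N) : inner x y = inner y x.
Proof. by apply: eq_bigr => i _; rewrite mulrC. Qed.

Lemma innerDr (R : realType) (N : nat) (x y z : 'cV[R]_N) :
  inner x (y + z) = inner x y + inner x z.
Proof. by rewrite !innerE mulmxDr mxE. Qed.

Lemma innerNr (R : realType) (N : nat) (x y : 'cV[R]_N) :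
  inner x (- y) = - inner x y.
Proof. by rewrite !innerE mulmxN mxE. Qed.

Lemma innerZr (R : realType) (N : nat) (a : R) (x y : 'cV[R]_N) :
  inner x (a *: y) = a * inner x y.
Proof. by rewrite !innerE -scalemxAr mxE. Qed.

Lemma innerDl (R : realType) (N : nat) (x y z : 'cV[R]_N) :
  inner (x + y) z = inner x z + inner y z.
Proof. by rewrite ![inner _ z]innerC innerDr. Qed.

Lemma innerNl (R : realType) (N : nat) (x y : 'cV[R]_N) :
  inner (- x) y = - inner x y.
Proof. by rewrite ![inner _ y]innerC innerNr. Qed.

Lemma innerZl (R : realType) (N : nat) (a : R) (x y : 'cV[R]_N) :
  inner (a *: x) y = a * inner x y.
Proof. by rewrite ![inner _ y]innerC innerZr. Qed.

Definition inner_lin := (innerDl, innerDr, innerNl, innerNr, innerZl, innerZr).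

Lemma inner_mulmx (R : realType) (N : nat) (A : 'M[R]_N) (x y : 'cV[R]_N) :
  inner x (A *m y) = inner (A^T *m x) y.
Proof. by rewrite !innerE trmx_mul trmxK mulmxA. Qed.

Lemma inner_ge0 (R : realType) (N : nat) (x : 'cV[R]_N) : 0 <= inner x x.
Proof. by apply: sumr_ge0 => i _; rewrite -expr2 sqr_ge0. Qed.

Lemma sqr_coord_le_inner (R : realType) (N : nat) (x : 'cV[R]_N) (i : 'I_N) :
  x i 0 ^+ 2 <= inner x x.
Proof.
rewrite /inner (bigD1 i)//= expr2 lerDl.
by apply: sumr_ge0 => j _; rewrite -expr2 sqr_ge0.
Qed.

(** The norm of a matrix is the maximum norm, attained at some entry. This bound carries estimates
    on [inner] over to the topology. *)
Lemma sqr_normr_le_inner (R : realType) (N : nat) (x : 'cV[R]_N) :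
  `|x| ^+ 2 <= inner x x.
Proof.
have [->|x0] := eqVneq `|x| 0; first by rewrite expr0n inner_ge0.
have [[i j] /= xE] := mx_norm_neq0 x0.
rewrite {1}/Num.norm/= xE real_normK ?num_real// (ord1 j).
exact: sqr_coord_le_inner.
Qed.

Lemma inner_gt0 (R : realType) (N : nat) (x : 'cV[R]_N) :
  x != 0 -> 0 < inner x x.
Proof.
move=> x0; apply: lt_le_trans (sqr_normr_le_inner _).
by rewrite exprn_gt0// normr_gt0.
Qed.

(** * Continuity and lower semicontinuity *)

Lemma inner_continuous (R : realType) (N : nat) (x : 'cV[R]_N) :
  continuous (fun z : 'cV[R]_N => inner (x - z) (x - z)).
Proof.
apply: continuous_big => [|i _ z]; first exact: add_continuous.
have -> : (fun z : 'cV[R]_N => (x - z) i 0 * (x - z) i 0) =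
    (fun z => (x i 0 - z i 0) * (x i 0 - z i 0)).
  by apply/funext => w; rewrite !mxE.
have c : {for z, continuous (fun z : 'cV[R]_N => x i 0 - z i 0)}.
  by apply: continuousB; [exact: cst_continuous|exact: coord_continuous].
exact: (continuousM c c).
Qed.

(** A neighbourhood of a matrix contains a product of neighbourhoods of its entries, so continuity
    of the finitely many coordinates suffices. *)
Lemma mulmx_continuous (R : realType) (m n : nat) (A : 'M[R]_(m, n)) :
  continuous (mulmx A : 'cV[R]_n -> 'cV[R]_m).
Proof.
move=> x B [P xP PB].
have cc i : continuous (fun y : 'cV[R]_n => (A *m y) i 0).
  under eq_fun do rewrite mxE.
  apply: continuous_big => [|j _ y]; first exact: add_continuous.
  have c : {for y, continuous (fun _ : 'cV[R]_n => A i j)}.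
    exact: cst_continuous.
  have c' : {for y, continuous (fun y : 'cV[R]_n => y j 0)}.
    exact: coord_continuous.
  exact: (continuousM c c').
have AP : nbhs x [set y | forall i, P i 0 ((A *m y) i 0)].
  apply: (@filter_forall _ _ (fun i y => P i 0 ((A *m y) i 0)) (nbhs x)) => i.
  by apply: cc; exact: xP.
apply: (filterS _ AP) => y yP.
by apply: PB => i j; rewrite (ord1 j); exact: yP.
Qed.

Lemma lower_semicontinuousDr (R : realType) (T : topologicalType)
    (h : T -> \bar R) (f : T -> R) :
  lower_semicontinuous h -> continuous f ->
  lower_semicontinuous (fun x => h x + (f x)%:E)%E.
Proof.
move=> lh cf x a; rewrite -lteBlDr// -EFinB => ah.
(* The level [b] splits the slack: near [x], [h] stays above [b] and [f] above [a - b]. *)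
have [b ab bh] : exists2 b, a - f x < b & (b%:E < h x)%E.
  case: (h x) ah => [r| |]//; rewrite ?lte_fin => ah.
    exists ((a - f x + r) / 2); rewrite ?lte_fin; lra.
  by exists (a - f x + 1); rewrite ?ltry//; lra.
have [U xU hU] := lh x b bh.
exists (U `&` [set y | a - b < f y]).
  apply: filterI => //; apply: (cf x [set r | a - b < r]); apply: lt_nbhsr; lra.
move=> y [/hU bhy /= abf]; rewrite -lteBlDr// -EFinB.
by apply: lt_trans bhy; rewrite lte_fin; lra.
Qed.

Lemma lower_semicontinuous_comp (R : realType) (S T : topologicalType)
    (h : T -> \bar R) (f : S -> T) :
  lower_semicontinuous h -> continuous f -> lower_semicontinuous (h \o f).
Proof.
move=> lh cf x a /lh[U xU hU]; exists (f @^-1` U); first exact: cf.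
by move=> y /hU.
Qed.

Lemma Gamma0_mulmx (R : realType) (N : nat) (h : 'cV[R]_N -> \bar R)
    (A : 'M[R]_N) :
  A \in unitmx -> Gamma0 h -> Gamma0 (h \o mulmx A).
Proof.
move=> uA [[hNy [x0 hx0]] lh ch]; split.
- by split=> [x|]; [exact: hNy|exists (invmx A *m x0); rewrite /= mulKVmx].
- exact: (lower_semicontinuous_comp lh (@mulmx_continuous _ _ _ A)).
- by move=> x y t t01 /=; rewrite mulmxDr -!scalemxAr; exact: ch.
Qed.

(** * Subgradients and the optimality condition for proximal points *)

Definition is_subgradient (R : realType) (N : nat) (h : 'cV[R]_N -> \bar R)
    (z v : 'cV[R]_N) : Prop :=
  h z \is a fin_num /\ forall y, (h z + (inner v (y - z))%:E <= h y)%E.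

(** Chain rule for a linear change of variable; invertibility makes every test point of [h] an image
    under [A]. *)
Lemma is_subgradient_mulmx (R : realType) (N : nat) (h : 'cV[R]_N -> \bar R)
    (A : 'M[R]_N) (z v : 'cV[R]_N) :
  A \in unitmx -> is_subgradient (h \o mulmx A) z (A^T *m v) <->
  is_subgradient h (A *m z) v.
Proof.
move=> uA; split=> -[fz sz]; split=> // y; last first.
  by rewrite -inner_mulmx mulmxBr; exact: sz.
have := sz (invmx A *m y).
by rewrite -inner_mulmx mulmxBr /= mulKVmx.
Qed.

Lemma is_subgradient_monotone (R : realType) (N : nat) (h : 'cV[R]_N -> \bar R)
    (z v z' v' : 'cV[R]_N) :
  is_subgradient h z v -> is_subgradient h z' v' ->
  0 <= inner (v - v') (z - z').
Proof.
move=> [fz sz] [fz' sz']; have := sz z'; have := sz' z.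
rewrite -(fineK fz) -(fineK fz') -!EFinD !lee_fin !inner_lin; lra.
Qed.

(** Fermat's rule. For a subgradient, expanding the square at [y] leaves the nonnegative remainder
    [q / 2]. Conversely, a minimiser [z] is compared with points of the segment from [z] to [y];
    convexity and division by the step [t] leave an error [t * (q / 2)] that vanishes with [t]. *)
Lemma prox_setP (R : realType) (N : nat) (V : 'M[R]_N) (h : 'cV[R]_N -> \bar R)
    (x z : 'cV[R]_N) :
  V^T = V -> (forall w, 0 <= inner w (V *m w)) ->
  proper_fun h -> convex_efun h ->
  prox_set V h x z <-> is_subgradient h z (V *m (x - z)).
Proof.
move=> sV pV hp hc.
have VC a b : inner a (V *m b) = inner b (V *m a).
  by rewrite inner_mulmx sV innerC.
split=> [zmin|[fz sz] y]; last first.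
  apply: le_trans (leeD2r _ (sz y)); rewrite -(fineK fz) -!EFinD lee_fin.
  have := pV (y - z); rewrite /sqnorm [inner (V *m _) _]innerC.
  rewrite !mulmxBr !inner_lin (VC y z) (VC z x) (VC y x); lra.
have [hNy [x0 hx0]] := hp.
have fx0 : h x0 \is a fin_num by rewrite fin_numE hNy.
have fz : h z \is a fin_num.
  rewrite fin_numE hNy /=; apply/eqP => hz.
  by have := zmin x0; rewrite hz -(fineK fx0) -EFinD.
split=> // y.
have [hy|hy] := eqVneq (h y) +oo%E; first by rewrite hy leey.
have fy : h y \is a fin_num by rewrite fin_numE hNy.
rewrite -(fineK fz) -(fineK fy) -EFinD lee_fin.
set p := inner _ _; set q := inner (y - z) (V *m (y - z)).
have key t : 0 < t <= 1 -> fine (h z) + p <= fine (h y) + t * (q / 2).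
  move=> /andP[t0 t1].
  have t01 : 0 <= t <= 1 by rewrite ltW.
  have := le_trans (zmin (t *: y + (1 - t) *: z)) (leeD2r _ (hc y z t t01)).
  rewrite -(fineK fz) -(fineK fy) -!EFinM -!EFinD lee_fin.
  have -> : x - (t *: y + (1 - t) *: z) = (x - z) - t *: (y - z).
    by apply/matrixP => i j; rewrite !mxE; ring.
  rewrite /sqnorm.
  have -> : inner (x - z - t *: (y - z)) (V *m (x - z - t *: (y - z))) =
      inner (x - z) (V *m (x - z)) - 2 * t * p + t ^+ 2 * q.
    rewrite /p /q [inner (V *m _) _]innerC.
    move: (x - z) (y - z) => a b.
    rewrite !mulmxBr -!scalemxAr !inner_lin (VC a b); ring.
  move=> H; rewrite -(ler_pM2l t0); nra.
have q0 : 0 <= q by exact: pV.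
apply/ler_addgt0Pr => e e0.
have q1 : 0 < q + 1 by lra.
(* This step stays in the unit interval and makes the error at most [e]; the shift [q + 1] avoids
   dividing by zero. *)
have := key (Num.min 1 (e / (q + 1))).
rewrite lt_min ltr01 divr_gt0//= ge_min lexx => /(_ isT) H.
apply: (le_trans H); rewrite lerD2l.
have : Num.min 1 (e / (q + 1)) <= e / (q + 1) by rewrite ge_min lexx orbT.
move=> /(ler_wpM2r (_ : 0 <= q / 2)) => /(_ ltac:(lra)) H'.
apply: (le_trans H'); rewrite mulrAC ler_pdivrMr//; nra.
Qed.

(** * Positive definite metrics and uniqueness of the proximal point *)

Lemma sym_posdefP (R : realType) (N : nat) (V : 'M[R]_N) :
  sym_posdef V <->
  V^T = V /\ forall x : 'cV[R]_N, x != 0 -> 0 < inner x (V *m x).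
Proof.
rewrite /sym_posdef.
have -> : (V \is symmetricmx) <-> V^T = V.
  split=> [/is_hermitianmxP|] VT.
    by rewrite {2}VT expr0 scale1r map_mx_id.
  by apply/is_hermitianmxP; rewrite expr0 scale1r map_mx_id.
by [].
Qed.

Lemma sym_posdef_ge0 (R : realType) (N : nat) (V : 'M[R]_N) (w : 'cV[R]_N) :
  sym_posdef V -> 0 <= inner w (V *m w).
Proof.
move=> [_ pV]; have [->|/pV/ltW//] := eqVneq w 0.
by rewrite /inner big1// => i _; rewrite mxE mul0r.
Qed.

Lemma sym_posdef1 (R : realType) (N : nat) : sym_posdef (1%:M : 'M[R]_N).
Proof.
apply/sym_posdefP; split=> [|x x0]; first exact: trmx1.
by rewrite mul1mx inner_gt0.
Qed.

(** Monotonicity applied to the subgradients [V (x - z)] and [V (x - z')] gives that minus the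
    squared [V]-norm of [z - z'] is nonnegative. *)
Lemma prox_set_inj (R : realType) (N : nat) (V : 'M[R]_N)
    (h : 'cV[R]_N -> \bar R) (x z z' : 'cV[R]_N) :
  sym_posdef V -> proper_fun h -> convex_efun h ->
  prox_set V h x z -> prox_set V h x z' -> z = z'.
Proof.
move=> V0 hp hc; have [tV pV] := (sym_posdefP V).1 V0.
have pV' w : 0 <= inner w (V *m w) by exact: sym_posdef_ge0.
move=> /(prox_setP _ _ tV pV' hp hc) Hz /(prox_setP _ _ tV pV' hp hc) Hz'.
have := is_subgradient_monotone Hz Hz'.
rewrite -mulmxBr.
have -> : x - z - (x - z') = - (z - z').
  by rewrite !opprB [_ - _ + _]addrC addrA subrK.
rewrite mulmxN innerNl innerC oppr_ge0 => H.
apply/eqP; rewrite -subr_eq0; apply/eqP.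
by apply: contra_leP H => /eqP; exact: pV.
Qed.

Lemma prox_set_prox (R : realType) (N : nat) (V : 'M[R]_N)
    (h : 'cV[R]_N -> \bar R) (x z : 'cV[R]_N) :
  sym_posdef V -> proper_fun h -> convex_efun h ->
  prox_set V h x z -> prox_set V h x = [set prox V h x] /\ prox V h x = z.
Proof.
move=> pV hp hc zP.
have pP : prox_set V h x (prox V h x) by exact: xgetI zP.
split; last exact: prox_set_inj pP zP.
by apply/seteqP; split=> [w /= wP|_ /= ->//]; exact: prox_set_inj wP pP.
Qed.

(** * Existence of the proximal point for the identity metric *)

(* Lower semicontinuity bounds h below by h x0 - 1 on a ball around a point x0
   of the domain; convexity along the segment from x0 to y propagates the bound
   to the whole space. *)
Lemma Gamma0_minorant (R : realType) (N : nat) (h : 'cV[R]_N -> \bar R) :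
  Gamma0 h ->
  exists c k : R, 0 <= k /\ forall y, ((c - k * `|y|)%:E <= h y)%E.
Proof.
move=> [[hNy [x0 hx0]] lh ch].
have f0 : h x0 \is a fin_num by rewrite fin_numE hNy.
set b := fine (h x0).
have [|U /nbhs_ballP[e /= e0 eU] hU] := lh x0 (b - 1).
  by rewrite -(fineK f0) -/b lte_fin; lra.
pose k := (e / 2)^-1.
have k0 : 0 < k by rewrite invr_gt0; lra.
have ke : k * (e / 2) = 1 by rewrite mulVf//; lra.
have hball y : `|x0 - y| < e -> ((b - 1)%:E < h y)%E.
  by move=> ye; apply: hU; apply: eU; rewrite -ball_normE.
exists (b - 1 - k * `|x0|), k; split; first exact: ltW.
move=> y; set n := `|x0 - y|.
have n0 : 0 <= n by exact: normr_ge0.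
have bn : b - 1 - k * `|x0| - k * `|y| <= b - 1 - k * n.
  have : n <= `|x0| + `|y| by exact: ler_normB.
  by nra.
apply: (@le_trans _ _ (b - 1 - k * n)%:E); first by rewrite lee_fin.
have [ne|en] := leP n (e / 2).
  have hy : ((b - 1)%:E < h y)%E by apply: hball; rewrite -/n; lra.
  by apply: ltW; apply: le_lt_trans hy; rewrite lee_fin; nra.
have n1 : 0 < n by lra.
(* With this [t] the point [t y + (1 - t) x0] lies at distance [t n = e / 2] from [x0], hence inside
   the ball. *)
pose t := (k * n)^-1.
have kn : 1 < k * n by rewrite -ke ltr_pM2l.
have tkn : t * (k * n) = 1 by rewrite mulVf//; lra.
have t0 : 0 < t by rewrite invr_gt0; lra.
have t1 : t <= 1 by rewrite invf_le1//; lra.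
have t01 : 0 <= t <= 1 by rewrite ltW.
have := hball (t *: y + (1 - t) *: x0).
have -> : x0 - (t *: y + (1 - t) *: x0) = t *: (x0 - y).
  by apply/matrixP => i j; rewrite !mxE; ring.
rewrite normrZ gtr0_norm// -/n => /(_ ltac:(nra)) hw.
have [->|hy] := eqVneq (h y) +oo%E; first exact: leey.
have fy : h y \is a fin_num by rewrite fin_numE hNy.
have := lt_le_trans hw (ch y x0 t t01).
rewrite -(fineK f0) -(fineK fy) -/b -!EFinM -!EFinD lte_fin lee_fin => H.
by rewrite -(ler_pM2l t0); nra.
Qed.

Lemma sqnorm1 (R : realType) (N : nat) (x : 'cV[R]_N) :
  sqnorm 1%:M x = inner x x.
Proof. by rewrite /sqnorm mul1mx. Qed.

(* By the parallelogram identity the sublevel sets of the objective shrink to a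
   point, so they generate a Cauchy filter. *)
Lemma prox_set1_nonempty (R : realType) (N : nat) (h : 'cV[R]_N -> \bar R)
    (x : 'cV[R]_N) :
  Gamma0 h -> prox_set 1%:M h x !=set0.
Proof.
move=> hG; have [c [k [k0 hck]]] := Gamma0_minorant hG.
have [[hNy [x0 hx0]] lh ch] := hG.
have f0 : h x0 \is a fin_num by rewrite fin_numE hNy.
pose q z := 2^-1 * inner (x - z) (x - z).
pose phi z := (h z + (q z)%:E)%E.
have lphi : lower_semicontinuous phi.
  apply: (lower_semicontinuousDr lh) => z.
  have c2 : {for z, continuous (fun _ : 'cV[R]_N => 2^-1 : R)}.
    exact: cst_continuous.
  by apply: (continuousM c2); exact: inner_continuous.
pose m := ereal_inf (range phi).
have mle z : (m <= phi z)%E by apply: ereal_inf_lbound; exists z.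
have fm : m \is a fin_num.
  rewrite fin_numE; apply/andP; split; last first.
    apply/eqP => mE; have := mle x0.
    by rewrite mE /phi -(fineK f0) -EFinD.
  (* With [r] the norm of [x - z], the affine minorant loses at most [k r] beyond [k |x|], and
     [r ^ 2 / 2 - k r] is at least [- k ^ 2 / 2]. *)
  rewrite -ltNye; apply: (@lt_le_trans _ _ (c - k * `|x| - k ^+ 2 / 2)%:E).
    by rewrite ltNyr.
  apply/ereal_infP => _ [z _ <-].
  apply: le_trans (leeD2r _ (hck z)); rewrite -EFinD lee_fin /q.
  have := sqr_normr_le_inner (x - z).
  have : `|z| <= `|x| + `|x - z|.
    by rewrite -[z in `|z|](subKr x); exact: ler_normB.
  move=> /(ler_wpM2l k0); have := sqr_ge0 (`|x - z| - k).
  nra.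
have mE := fineK fm; set m' := fine m in mE.
pose S e := [set z | (phi z < (m' + e)%:E)%E].
have S0 e : 0 < e -> S e !=set0.
  move=> e0; have [_ [z _ <-]] := lb_ereal_inf_adherent e0 fm.
  by rewrite -/m -mE -EFinD => zS; exists z.
(* The objective at the midpoint is at least [m'] and at most the mean of its values at [a] and [b]
   minus one eighth of the squared distance. *)
have Sclose e a b : S e a -> S e b -> inner (a - b) (a - b) < 8 * e.
  move=> aS bS.
  have fin z : S e z -> h z \is a fin_num.
    rewrite /S/= /phi fin_numE hNy /= => zS; apply/eqP => hz.
    by move: zS; rewrite hz.
  have half : 0 <= (2^-1 : R) <= 1 by lra.
  have /(le_trans (mle _)) := leeD2r (q (2^-1 *: a + (1 - 2^-1) *: b))%:E
    (ch a b 2^-1 half).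
  move: aS bS (fin a aS) (fin b bS); rewrite /S/= /phi => aS bS fa fb.
  move: aS bS; rewrite -mE -(fineK fa) -(fineK fb) -!EFinM -!EFinD.
  rewrite !lte_fin lee_fin /q.
  have -> : x - (2^-1 *: a + (1 - 2^-1) *: b) =
      2^-1 *: ((x - a) + (x - b)).
    by apply/matrixP => i j; rewrite !mxE; field.
  have -> : a - b = (x - b) - (x - a).
    by rewrite opprB [RHS]addrC addrA subrK.
  move: (x - a) (x - b) => v w.
  rewrite !inner_lin (innerC w v); lra.
pose F := filter_from [set e : R | 0 < e] S.
have FF : ProperFilter F.
  apply: filter_from_proper => [|e]; last exact: S0.
  apply: filter_from_filter; first by exists 1 => /=.
  move=> i j /= i0 j0; exists (Num.min i j); first by rewrite /= lt_min i0.
  move=> z; rewrite /S/= => zS.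
  by split; apply: (lt_le_trans zS); rewrite lee_fin lerD2l ge_min lexx ?orbT.
have : cauchy F.
  apply: cauchy_exP => e e0.
  (* Chosen so that [Sclose] bounds squared distances by [e ^ 2]. *)
  have e8 : 0 < e ^+ 2 / 8 by rewrite divr_gt0// exprn_gt0.
  have [a aS] := S0 _ e8; exists a; exists (e ^+ 2 / 8) => // b bS.
  rewrite -ball_normE /=.
  rewrite -(@ltr_pXn2r _ 2)// ?nnegrE ?normr_ge0 ?(ltW e0)//.
  apply: (le_lt_trans (sqr_normr_le_inner _)).
  have := Sclose _ _ _ aS bS; lra.
move=> /cauchy_cvgP/cvg_ex[z Fz]; exists z => y /=.
rewrite !sqnorm1 -/(q z) -/(q y) -/(phi z) -/(phi y).
(* The limit is a minimiser: if [phi z] exceeded the infimum, lower semicontinuity would keep [phi]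
   above some [a > m'] near [z], yet the sublevel set at height [a] meets every neighbourhood of
   [z]. *)
apply: le_trans (mle y); rewrite -mE leNgt; apply/negP => mz.
have [a ma az] : exists2 a, m' < a & (a%:E < phi z)%E.
  case: (phi z) mz => [r| |]//; rewrite ?lte_fin => mr.
    by exists ((m' + r) / 2); rewrite ?lte_fin; lra.
  by exists (m' + 1); rewrite ?ltry//; lra.
have [U zU aU] := lphi z a az.
have [w [wS wU]] : S (a - m') `&` U !=set0.
  apply: (@filter_ex _ F); apply: filterI; last exact: Fz.
  by exists (a - m') => //=; rewrite subr_gt0.
have := lt_trans (aU w wU) wS.
by rewrite addrC subrK ltxx.
Qed.

(** * Cauchy-Schwarz for semidefinite forms, and roots of strongly increasing functions *)

Lemma sqr_inner_le (R : realType) (N : nat) (V : 'M[R]_N) (x y : 'cV[R]_N) :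
  V^T = V -> (forall w, 0 <= inner w (V *m w)) ->
  inner x (V *m y) ^+ 2 <= inner x (V *m x) * inner y (V *m y).
Proof.
move=> sV pV.
have key t : 0 <= inner x (V *m x) - 2 * t * inner x (V *m y)
                  + t ^+ 2 * inner y (V *m y).
  have VC : inner y (V *m x) = inner x (V *m y).
    by rewrite inner_mulmx sV innerC.
  have := pV (x - t *: y).
  rewrite mulmxBr -scalemxAr !inner_lin VC; lra.
move: (pV x) (pV y) key.
set n := inner x (V *m x); set k := inner y _; set q := inner x _.
move=> n0 k0 key.
have [k_eq0|k_neq0] := eqVneq k 0.
  have [->|q0] := eqVneq q 0; first by rewrite expr0n mulr_ge0.
  (* If the quadratic in [t] degenerates to an affine function of nonzero slope, this [t] gives it
     the negative value [- n - 2]. *)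
  have := key ((n + 1) / q); rewrite k_eq0 mulr0 addr0.
  by rewrite -mulrA mulfVK//; lra.
have kp : 0 < k by rewrite lt_def k_neq0.
(* The minimiser of the quadratic in [t]. *)
have := key (q / k).
have -> : n - 2 * (q / k) * q + (q / k) ^+ 2 * k = (n * k - q ^+ 2) / k.
  by field.
by rewrite pmulr_lge0 ?invr_gt0// subr_ge0.
Qed.

Lemma klipschitz_continuous (R : realType) (k : R) (f : R -> R) :
  0 < k -> k.-lipschitz f -> continuous f.
Proof.
move=> k0 fk x; apply/cvgrPdist_lt => e e0; near=> y.
apply: le_lt_trans (fk (x, y) _) _ => //=.
rewrite mulrC -ltr_pdivlMr//.
near: y; apply: cvgr_dist_lt; last exact: divr_gt0.
exact: cvg_id.
Unshelve. all: by end_near. Qed.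

Lemma strongly_increasing_root (R : realType) (f : R -> R) :
  strongly_increasing f -> continuous f ->
  exists a, f a = 0 /\ forall b, f b = 0 -> b = a.
Proof.
move=> [c c0 fc] cf.
(* Growth at rate [c] away from 0 outweighs [f 0] at distance [A], so [f] changes sign between [- A]
   and [A]; the added 1 keeps [A] positive. *)
pose A := (`|f 0| + 1) / c.
have A0 : 0 < A by rewrite divr_gt0// ltr_wpDl.
have cA : c * A = `|f 0| + 1 by rewrite /A mulrC mulfVK//; lra.
have fA : 0 <= f A.
  have := fc A 0; rewrite subr0 expr2 mulrA ler_pM2r// cA.
  have := ler_norm (- f 0); rewrite normrN; lra.
have fNA : f (- A) <= 0.
  have := fc 0 (- A); rewrite opprK add0r expr2 mulrA ler_pM2r// cA.
  have := ler_norm (f 0); lra.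
have [|||a _ fa] := @IVT R f (- A) A 0; first lra.
- exact: continuous_subspaceT.
- by rewrite ge_min fNA le_max fA orbT.
exists a; split=> // b fb.
have := fc b a; rewrite fa fb subrr mul0r => ba.
apply/eqP; rewrite -subr_eq0 -sqrf_eq0 eq_le sqr_ge0 andbT.
by rewrite -(ler_pM2l c0) mulr0.
Qed.

(** * The scaled proximal map along the direction [u] *)

Section DiagPMRank1.
Variables (R : realType) (N : nat) (h : 'cV[R]_N -> \bar R) (s : bool).
Variables (d : 'rV[R]_N) (u : 'cV[R]_N).
Hypothesis hG : Gamma0 h.
Hypothesis d0 : forall i, 0 < d 0 i.

Let D := diag_mx d.
Let S := diag_sqrt d.
Let sg : R := (-1) ^+ s.
Let y := invmx D *m u.
Let k := \sum_(i < N) u i 0 ^+ 2 / d 0 i.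

Lemma diag_sqrtK : S *m S = D.
Proof.
rewrite /S /diag_sqrt mulmx_diag; congr diag_mx.
by apply/rowP => i; rewrite !mxE -expr2 sqr_sqrtr// ltW.
Qed.

Lemma diag_unitmx : D \in unitmx.
Proof.
rewrite unitmxE det_diag unitfE; apply/prodf_neq0 => i _.
by rewrite gt_eqF.
Qed.

Lemma diag_sqrt_unitmx : S \in unitmx.
Proof.
by have := diag_unitmx; rewrite -diag_sqrtK unitmx_mul => /andP[].
Qed.

Lemma diag_form_ge0 (w : 'cV[R]_N) : 0 <= inner w (D *m w).
Proof.
apply: sumr_ge0 => i _; rewrite mul_diag_mx mxE mulrCA -expr2.
by rewrite mulr_ge0 ?sqr_ge0// ltW.
Qed.

Lemma diag_invmx_form : inner y (D *m y) = k.
Proof.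
rewrite mulKVmx ?diag_unitmx//.
have -> : y = \col_i (u i 0 / d 0 i).
  apply: (can_inj (mulKmx diag_unitmx)); rewrite mulKVmx ?diag_unitmx//.
  apply/colP => i; rewrite mul_diag_mx !mxE mulrC divfK//.
  by rewrite gt_eqF.
by apply: eq_bigr => i _; rewrite mxE mulrAC expr2.
Qed.

Lemma prox_set_scaled (w : 'cV[R]_N) :
  prox_set 1%:M (h \o mulmx (invmx S)) w =
    [set prox 1%:M (h \o mulmx (invmx S)) w].
Proof.
have gG : Gamma0 (h \o mulmx (invmx S)).
  by apply: Gamma0_mulmx => //; rewrite unitmx_inv diag_sqrt_unitmx.
have [z zP] := prox_set1_nonempty w gG; have [gp _ gc] := gG.
by have [] := prox_set_prox (sym_posdef1 R N) gp gc zP.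
Qed.

(** At the scaled argument [w], optimality makes [w - p] a subgradient of the rescaled function at
    [p]. The chain rule turns it into the subgradient [S (w - p)] of [h] at [z], and [S * S = D]
    gives the stated form. *)
Lemma shifted_prox_subgradient (x : 'cV[R]_N) (a : R) :
  let z := shifted_prox s d u h x a in
  is_subgradient h z (D *m (x - z) - (sg * a) *: u).
Proof.
rewrite /shifted_prox -/S -/sg -/D -/y /=.
set w := S *m _; set p := prox _ _ _; set z := invmx S *m p.
have uiS : invmx S \in unitmx by rewrite unitmx_inv diag_sqrt_unitmx.
have [gp _ gc] := Gamma0_mulmx uiS hG.
have : prox_set 1%:M (h \o mulmx (invmx S)) w p by rewrite prox_set_scaled.
have p1 (v : 'cV[R]_N) : 0 <= inner v (1%:M *m v).
  exact/sym_posdef_ge0/sym_posdef1.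
move=> /(prox_setP _ _ (trmx1 _ _) p1 gp gc); rewrite mul1mx => Hp.
apply/(is_subgradient_mulmx _ _ _ uiS).
rewrite trmx_inv tr_diag_mx -/(diag_sqrt d) -/S.
suff <- : S *m (w - p) = D *m (x - z) - (sg * a) *: u.
  by rewrite mulKmx ?diag_sqrt_unitmx.
have Sp : S *m p = D *m z.
  by rewrite /z -diag_sqrtK -mulmxA mulKVmx ?diag_sqrt_unitmx.
rewrite mulmxBr Sp /w mulmxA diag_sqrtK !mulmxBr -!scalemxAr scalerA.
by rewrite /y mulKVmx ?diag_unitmx// addrAC.
Qed.

(** Since [D y = u], the left side is the square of a [D]-product with [y]. Cauchy-Schwarz bounds it
    by [k] times the [D]-form of the difference, which monotonicity controls. *)
Lemma shifted_prox_monotone (x : 'cV[R]_N) (a b : R) :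
  inner u (shifted_prox s d u h x a - shifted_prox s d u h x b) ^+ 2 <=
  k * - (sg * (a - b) *
    inner u (shifted_prox s d u h x a - shifted_prox s d u h x b)).
Proof.
have := is_subgradient_monotone (shifted_prox_subgradient x a)
  (shifted_prox_subgradient x b).
move: (shifted_prox _ _ _ _ _ a) (shifted_prox _ _ _ _ _ b) => z z'.
have -> : D *m (x - z) - (sg * a) *: u - (D *m (x - z') - (sg * b) *: u) =
    - (D *m (z - z')) - (sg * (a - b)) *: u.
  rewrite !mulmxBr; move: (D *m x) (D *m z) (D *m z') => p q r.
  by apply/matrixP => i j; rewrite !mxE; ring.
rewrite !(innerDl, innerNl, innerZl) [inner (D *m _) _]innerC => H.
have := sqr_inner_le y (z - z') (tr_diag_mx d) diag_form_ge0.
rewrite diag_invmx_form inner_mulmx tr_diag_mx mulKVmx ?diag_unitmx//.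
move=> /le_trans; apply; apply: ler_wpM2l; last lra.
by apply: sumr_ge0 => i _; rewrite divr_ge0 ?sqr_ge0// ltW.
Qed.

End DiagPMRank1.

Unset Implicit Arguments.

Theorem theorem3p8 (R : realType) (N : nat) (h : 'cV[R]_N -> \bar R)
    (s : bool) (d : 'rV[R]_N) (u : 'cV[R]_N) :
  Gamma0 h ->
  (forall i, 0 < d 0 i) ->
  sym_posdef (diag_pm_rank1 s d u) ->
  [/\ forall x, prox_set (diag_pm_rank1 s d u) h x =
                [set prox (diag_pm_rank1 s d u) h x],
      forall y, prox_set 1%:M (h \o mulmx (invmx (diag_sqrt d))) y =
                [set prox 1%:M (h \o mulmx (invmx (diag_sqrt d))) y] &
      forall x,
        [/\ strongly_increasing (root_fun s d u h x),
            (1 + \sum_(i < N) u i 0 ^+ 2 / d 0 i).-lipschitz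
              (root_fun s d u h x) &
            exists a : R,
              [/\ root_fun s d u h x a = 0,
                  forall b : R, root_fun s d u h x b = 0 -> b = a &
                  prox (diag_pm_rank1 s d u) h x = shifted_prox s d u h x a]]].
Proof.
move=> hG d0 pV.
have [hp _ hc] := hG.
set V := diag_pm_rank1 s d u in pV *.
set k := \sum_(i < N) _.
have k0 : 0 <= k by apply: sumr_ge0 => i _; rewrite divr_ge0 ?sqr_ge0// ltW.
have [tV pV'] := (sym_posdefP V).1 pV.
have psdV w : 0 <= inner w (V *m w) by exact: sym_posdef_ge0.
have VE w : V *m w = diag_mx d *m w + ((-1) ^+ s * inner u w) *: u.
  rewrite /V /diag_pm_rank1 mulmxDl -scalemxAl -mulmxA -scalerA.
  congr (_ + _ *: _).
  by apply/matrixP => i j; rewrite !mxE big_ord1 innerE (ord1 j) mulrC.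
have s1k : s -> k < 1.
  move=> st; pose y := invmx (diag_mx d) *m u.
  have yk : inner y (diag_mx d *m y) = k by exact: diag_invmx_form.
  have uyk : inner u y = k.
    by rewrite innerC -yk /y mulKVmx// diag_unitmx.
  have [y0|/pV'] := eqVneq y 0.
    suff -> : k = 0 by exact: ltr01.
    by rewrite -yk y0 /inner big1// => i _; rewrite mxE mul0r.
  (* For the minus sign the form of [V] at [y] equals [k - k ^ 2], and its positivity forces
     [k < 1]. *)
  by rewrite VE innerDr yk innerZr uyk [inner y u]innerC uyk st expr1; nra.
have root_funB x a b : root_fun s d u h x a - root_fun s d u h x b =
    a - b - inner u (shifted_prox s d u h x a - shifted_prox s d u h x b).
  rewrite /root_fun.
  move: (shifted_prox _ _ _ _ _ a) (shifted_prox _ _ _ _ _ b) => z z'.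
  by rewrite !inner_lin; ring.
have incr x : strongly_increasing (root_fun s d u h x).
  (* The increment of [root_fun] times [t = a - b] is [t ^ 2 - t q]. The product [t q] is at most
     [k t ^ 2] for the minus sign and at most 0 for the plus sign. *)
  exists (if s then 1 - k else 1) => [|a b].
    by case: (s) s1k => [/(_ isT)|_]; lra.
  rewrite root_funB.
  have := shifted_prox_monotone s u hG d0 x a b; rewrite -/k.
  move: (inner u _) => q; move: (a - b) => t; clear -k0 s1k.
  case: s s1k => [/(_ isT)|] k1; rewrite ?expr0 ?expr1 => H.
    have tq : t * q <= k * t ^+ 2.
      have [tq|tq] := leP (t * q) 0.
        by apply: le_trans tq _; rewrite mulr_ge0 ?sqr_ge0.
      (* Multiplying [q ^ 2 <= k t q] by [t ^ 2] lets the positive factor [t q] be cancelled. *)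
      rewrite -(ler_pM2l tq); have := ler_wpM2l (sqr_ge0 t) H; lra.
    by lra.
  have [k_eq0|k_neq0] := eqVneq k 0.
    have q0 : q = 0.
      apply/eqP; rewrite -sqrf_eq0 eq_le sqr_ge0 andbT (le_trans H)//.
      by rewrite k_eq0 mul0r.
    by rewrite q0; lra.
  have kp : 0 < k by rewrite lt_def k_neq0.
  have := le_trans (sqr_ge0 q) H; rewrite pmulr_rge0//; lra.
have lip x : (1 + k).-lipschitz (root_fun s d u h x).
  move=> [a b] _ /=; rewrite root_funB.
  have := shifted_prox_monotone s u hG d0 x a b; rewrite -/k.
  move: (inner u _) => q; move: (a - b) => t H.
  apply: (le_trans (ler_normB _ _)); rewrite mulrDl mul1r lerD2l.
  (* It remains to bound the absolute value of [q] by [k] times that of [t], by cancelling one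
     factor of [q] in the quadratic bound. *)
  have [->|q0] := eqVneq q 0; first by rewrite normr0 mulr_ge0.
  have q1 : 0 < `|q| by rewrite normr_gt0.
  rewrite -(ler_pM2l q1) -expr2 real_normK ?num_real//.
  apply: (le_trans H); rewrite mulrCA ler_wpM2l//.
  apply: (le_trans (ler_norm _)).
  by rewrite normrN !normrM normrX normrN1 expr1n mul1r mulrC.
have main x : exists a, [/\ root_fun s d u h x a = 0,
    forall b, root_fun s d u h x b = 0 -> b = a &
    prox_set V h x (shifted_prox s d u h x a)].
  have k1 : 0 < 1 + k by lra.
  have [a [fa ua]] :=
    strongly_increasing_root (incr x) (klipschitz_continuous k1 (lip x)).
  exists a; split=> //; apply/(prox_setP _ _ tV psdV hp hc).
  (* At the root, [V (x - z)] becomes exactly the subgradient provided by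
     [shifted_prox_subgradient]. *)
  rewrite VE; have -> : inner u (x - shifted_prox s d u h x a) = - a.
    by move: fa; rewrite /root_fun; lra.
  by rewrite mulrN scaleNr; exact: shifted_prox_subgradient.
split=> [x|z|x]; last split=> //.
- by have [a [_ _ aP]] := main x; have [] := prox_set_prox pV hp hc aP.
- exact: prox_set_scaled.
- have [a [fa ua aP]] := main x; exists a; split=> //.
  by have [] := prox_set_prox pV hp hc aP.
Qed.
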